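(* Let $q\ge 2$. For every integer $n\ge 1$, the number $B_n(q)$ of symmetric $q$-ary strong lonesum $n\times n$ matrices equals $$1+\sum_{j=1}^{n}\ \sum_{(n_0,\ldots,n_j)\in\mathcal{S}_n^j}\binom{n}{n_0,n_1,\ldots,n_j}\left(\prod_{i=1}^{\lfloor j/2\rfloor}f_q(n_{2i-1},n_{2i})\right)\left(1+(q-2)\Big(n-\sum_{i=0}^{2\lfloor j/2\rfloor}n_i\Big)\right),$$ where $f_q(r,s)=1+(q-2)rs+r\big((q-1)^s-(q-2)s-1\big)+s\big((q-1)^r-(q-2)r-1\big)$.
   Context: A $q$-ary matrix has entries in $\{0,1,\ldots,q-1\}$; a $q$-ary $m\times n$ matrix is a strong lonesum matrix if no other $q$-ary $m\times n$ matrix has the same row sums and column sums. A symmetric strong lonesum matrix is a square matrix $M=M^{T}$ that is a strong lonesum matrix. For $j\ge 1$ and $l\ge 1$, $\mathcal{S}_l^j=\{(l_0,l_1,\ldots,l_j)\in\mathbb{Z}^{j+1}: \sum_{i=0}^j l_i=l,\ l_0\ge 0,\ l_i\ge 1 \text{ for } 1\le i\le j\}$. $\binom{l}{l_0,\ldots,l_j}=\frac{l!}{l_0!\cdots l_j!}$ is the multinomial coefficient. *)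

(* Defs.v *)
From HB Require Import structures.
From mathcomp Require Import all_boot all_order all_algebra.
Set Implicit Arguments. Unset Strict Implicit. Unset Printing Implicit Defensive.
Import Order.TTheory GRing.Theory Num.Theory.

Definition row_sum (q m n : nat) (M : 'M['I_q]_(m, n)) (i : 'I_m) : nat :=
  \sum_(j < n) nat_of_ord (M i j).
Definition col_sum (q m n : nat) (M : 'M['I_q]_(m, n)) (j : 'I_n) : nat :=
  \sum_(i < m) nat_of_ord (M i j).

Definition strong_lonesum (q m n : nat) (M : 'M['I_q]_(m, n)) : bool :=
  [forall N : 'M['I_q]_(m, n),
    ([forall i, row_sum N i == row_sum M i] &&
     [forall j, col_sum N j == col_sum M j]) ==> (N == M)].

Definition symmetric_strong_lonesum (q n : nat) (M : 'M['I_q]_n) : bool :=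
  (trmx M == M) && strong_lonesum M.

Definition B (q n : nat) : nat :=
  #|[set M : 'M['I_q]_n | symmetric_strong_lonesum M]|.

Definition multinom (l : nat) (s : seq nat) : nat :=
  l`! %/ \prod_(x <- s) x`!.

(* Tuples (l_0,...,l_j) with 0 <= l_i <= n, encoded as ffuns 'I_j.+1 -> 'I_n.+1;
   membership in S_n^j : sum = n, l_0 >= 0, l_i >= 1 for 1 <= i <= j.
   (Every element of S_n^j has all entries <= n, so this encoding is complete.) *)
Definition inS (n j : nat) (t : {ffun 'I_j.+1 -> 'I_n.+1}) : bool :=
  ((\sum_(i < j.+1) nat_of_ord (t i)) == n) &&
  [forall i : 'I_j.+1, (0 < nat_of_ord i) ==> (0 < nat_of_ord (t i))].

(* k-th component n_k of the tuple t (valid for k <= j) *)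
Definition comp (n j : nat) (t : {ffun 'I_j.+1 -> 'I_n.+1}) (k : nat) : nat :=
  nat_of_ord (t (inord k)).

Open Scope ring_scope.

Definition fq (q r s : nat) : int :=
  1 + (q%:Z - 2) * r%:Z * s%:Z
    + r%:Z * ((q%:Z - 1) ^+ s - (q%:Z - 2) * s%:Z - 1)
    + s%:Z * ((q%:Z - 1) ^+ r - (q%:Z - 2) * r%:Z - 1).

Definition formula (q n : nat) : int :=
  1 + \sum_(1 <= j < n.+1)
        \sum_(t : {ffun 'I_j.+1 -> 'I_n.+1} | inS t)
          (multinom n [seq comp t k | k <- iota 0 j.+1])%:Z
          * (\prod_(1 <= i < (j./2).+1) fq q (comp t (2 * i - 1)) (comp t (2 * i)))
          * (1 + (q%:Z - 2) *
                 (n%:Z - (\sum_(0 <= i < (j./2).*2.+1) comp t i)%:Z)).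
Close Scope ring_scope.

(* Main.v *)
(* If two rows of a strong lonesum matrix could exchange a unit between two
   columns, uniqueness would fail; so the support of a symmetric one is a
   symmetric relation with nested neighbourhoods. Ranking the indices by
   neighbourhood gives a unique [g] onto the classes [1..j] (plus possibly class
   [0]) with [M x y > 0] iff [g x + g y > j]. The exchange condition then forces
   [M x y = q - 1] whenever [g x + g y > j + 1], while in each corner block
   [g x + g y = j + 1] the non-maximal entries lie on one line. Conversely, such a
   matrix maximises the linear functional with weights [g x + g y - (j + 1)],
   which depends only on the row and column sums, hence is strong lonesum. The
   blocks being independent up to transposition, the count is a sum over [g] of a
   product over pairs of classes [i, j + 1 - i], and over the middle class if [j]
   is odd. *)
Require Import Defs.
From HB Require Import structures.
From mathcomp Require Import all_boot all_order all_algebra.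
From mathcomp Require Import zify ring.
Set Implicit Arguments. Unset Strict Implicit. Unset Printing Implicit Defensive.
Import Order.TTheory GRing.Theory Num.Theory.

(** * Unit exchanges in strong lonesum matrices *)

Lemma sum_nat_pred1_andr (n : nat) (y : 'I_n) (c : bool) :
  \sum_(b < n) (c && (b == y) : nat) = c.
Proof.
by case: c => /=; [rewrite -big_mkcond /= big_pred1_eq | rewrite big1].
Qed.

(** Otherwise moving one unit from [(x, y)] to [(x, y')] and one from [(x', y')] to [(x', y)] keeps
    all row and column sums and all entries in range, yielding a second matrix with the same
    sums. *)
Lemma strong_lonesum_no_swap (p m n : nat) (M : 'M['I_p.+1]_(m, n)) x x' y y' :
  strong_lonesum M -> x != x' -> y != y' -> 0 < M x y -> 0 < M x' y' ->
  (p <= M x y') || (p <= M x' y).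
Proof.
move=> /forallP sl nx ny Mxy Mx'y'; rewrite leqNgt (leqNgt p) -negb_and.
apply/negP => /andP[lt1 lt2].
pose inc a b := ((a == x) && (b == y') : nat) + ((a == x') && (b == y)).
pose dec a b := ((a == x) && (b == y) : nat) + ((a == x') && (b == y')).
pose N : 'M['I_p.+1]_(m, n) :=
  (\matrix_(a, b) inord (M a b + inc a b - dec a b))%R.
(* The additive form avoids truncated subtraction, so that the equal row and column totals of [inc]
   and [dec] can be cancelled. *)
have NE a b : N a b + dec a b = M a b + inc a b.
  have := ltn_ord (M a b); rewrite mxE /inc /dec.
  case: (eqVneq a x) => [->|ax]; case: (eqVneq a x') => [e|ax'] //=;
    case: (eqVneq b y) => [->|by_]; case: (eqVneq b y') => [e'|by'] //= lt;
    rewrite ?inordK //; subst; rewrite ?eqxx in nx ny *; lia.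
have row a : row_sum N a = row_sum M a.
  rewrite /row_sum; have : \sum_b (N a b + dec a b) = \sum_b (M a b + inc a b).
    by apply: eq_bigr => b _; apply: NE.
  by rewrite !big_split /= !sum_nat_pred1_andr => /addIn.
have col b : col_sum N b = col_sum M b.
  rewrite /col_sum; have : \sum_a (N a b + dec a b) = \sum_a (M a b + inc a b).
    by apply: eq_bigr => a _; apply: NE.
  rewrite !big_split /=.
  have swap c (z : 'I_m) : \sum_a ((a == z) && c : nat) = c.
    by rewrite -[RHS](sum_nat_pred1_andr z); apply: eq_bigr => a _; rewrite andbC.
  by rewrite !swap [(b == y) + _]addnC => /addIn.
have /implyP := sl N.
have -> /= : [forall i, row_sum N i == row_sum M i] &&
             [forall j, col_sum N j == col_sum M j].
  by apply/andP; split; apply/forallP => ?; rewrite (row, col).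
move=> /(_ isT) /eqP NM; have := NE x y.
by rewrite NM /inc /dec !eqxx (negbTE nx) (negbTE ny) /= => /addnI.
Qed.

(** By counting, [f] is a bijection from [A] onto the integers below [#|A|]. *)
Lemma card_inj_ltn (T : finType) (A : {set T}) (f : T -> nat) (m : nat) :
  {in A &, injective f} -> {in A, forall x, f x < #|A|} -> m <= #|A| ->
  #|[set x in A | f x < m]| = m.
Proof.
move=> injf fA le_m.
have sub : {subset map f (enum A) <= iota 0 #|A|}.
  by move=> k /mapP[x]; rewrite mem_enum => xA ->; rewrite mem_iota fA.
have uniqf : uniq (map f (enum A)).
  by rewrite map_inj_in_uniq ?enum_uniq // => x y; rewrite !mem_enum; apply: injf.
have szf : size (iota 0 #|A|) <= size (map f (enum A)).
  by rewrite size_map size_iota -cardE.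
have eqf := (uniq_min_size uniqf sub szf).2.
have /perm_size : perm_eq (filter (fun k => k < m) (map f (enum A))) (iota 0 m).
  apply: uniq_perm; rewrite ?filter_uniq ?iota_uniq // => k.
  rewrite mem_filter eqf !mem_iota /=; lia.
rewrite size_iota filter_map size_map => {2}<-.
rewrite cardE; apply/perm_size/uniq_perm; first exact: enum_uniq.
  by rewrite filter_uniq // enum_uniq.
by move=> x; rewrite mem_enum mem_filter mem_enum inE andbC.
Qed.

(** * Nested neighbourhoods and their ranks *)

Definition nbhd (n : nat) (T : rel 'I_n) (x : 'I_n) : {set 'I_n} := [set y | T x y].
Definition chain (n : nat) (T : rel 'I_n) : {set {set 'I_n}} :=
  [set nbhd T x | x : 'I_n] :\ set0.
(** For nested neighbourhoods this is the position of [nbhd T x] in the chain of nonempty ones; rank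
    0 means an empty neighbourhood. *)
Definition rank (n : nat) (T : rel 'I_n) (x : 'I_n) : nat :=
  #|[set S in chain T | S \subset nbhd T x]|.

Lemma chain_le (n : nat) (T : rel 'I_n) : #|chain T| <= n.
Proof.
apply: leq_trans (subset_leq_card (subD1set _ _)) _.
by apply: leq_trans (leq_imset_card _ _) _; rewrite card_ord.
Qed.

Definition cross_free (n : nat) (T : rel 'I_n) : Prop :=
  forall x x' y y', T x y -> T x' y' -> T x y' || T x' y.

Lemma chain_rep (n : nat) (T : rel 'I_n) S :
  S \in chain T -> exists2 x, S = nbhd T x & S != set0.
Proof. by rewrite !inE => /andP[S0 /imsetP[x _ e]]; exists x. Qed.

Lemma mem_chain (n : nat) (T : rel 'I_n) x y : T x y -> nbhd T x \in chain T.
Proof.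
move=> Txy; rewrite !inE imset_f // andbT; apply/set0Pn; exists y.
by rewrite inE.
Qed.

Lemma nbhd_total (n : nat) (T : rel 'I_n) x x' : cross_free T ->
  (nbhd T x \subset nbhd T x') || (nbhd T x' \subset nbhd T x).
Proof.
move=> cf; apply/orP; case: (boolP (_ \subset _)) => [|/subsetPn[y]]; first by left.
rewrite !inE => Txy nTx'y; right; apply/subsetP => y'; rewrite !inE => Tx'y'.
by have := cf _ _ _ _ Txy Tx'y'; rewrite (negbTE nTx'y) orbF.
Qed.

(** The members of the chain avoiding [y] and those inside [nbhd T x] are both initial segments of
    the chain; the former is strictly shorter exactly when [nbhd T x] contains [y]. *)
Lemma mem_nbhd_rank (n : nat) (T : rel 'I_n) x y : cross_free T ->
  T x y = (#|[set S in chain T | y \notin S]| < rank T x).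
Proof.
move=> cf; apply/idP/idP => [Txy|]; last first.
  apply: contraTT => nTxy; rewrite -leqNgt; apply/subset_leq_card/subsetP => S.
  rewrite inE [in X in _ -> X]inE => /andP[-> sub] /=; apply: contra nTxy => yS.
  by have := subsetP sub _ yS; rewrite inE.
apply: proper_card; apply/properP; split.
  apply/subsetP => S; rewrite inE [in X in _ -> X]inE => /andP[Sc nyS].
  rewrite Sc; have [x' eS _] := chain_rep Sc; rewrite eS in nyS *.
  have /orP[//|/subsetP/(_ y)] := nbhd_total x' x cf.
  by rewrite inE Txy (negbTE nyS) => /(_ isT).
by exists (nbhd T x); rewrite inE (mem_chain Txy) ?subxx // inE negbK.
Qed.

(** Let [L y] count the members of the chain avoiding [y]. By symmetry [L y] depends only on the
    neighbourhood of [y] and separates distinct neighbourhoods, so on the chain it takes each value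
    below [j] once. Hence exactly [rank T y] members contain [y], and [L y = j - rank T y] turns the
    criterion [L y < rank T x] into one on the sum of ranks. *)
Lemma mem_nbhd_rank_add (n : nat) (T : rel 'I_n) : symmetric T -> cross_free T ->
  (forall x y, T x y = (#|chain T| < rank T x + rank T y)) /\
  (forall k, 0 < k <= #|chain T| -> exists x, rank T x = k).
Proof.
move=> symT cf; set j := #|chain T|.
pose L y := #|[set S in chain T | y \notin S]|.
have TE x y : T x y = (L y < rank T x) by apply: mem_nbhd_rank.
(* [L] transported to the chain; the default branch is never taken there, as every member is a
   neighbourhood. *)
pose l S := if [pick x | S == nbhd T x] is Some x then L x else 0.
have lE x : l (nbhd T x) = L x.
  rewrite /l; case: pickP => [z /eqP e|/(_ x)]; last by rewrite eqxx.
  apply/eq_card => S; rewrite in_set [RHS]in_set.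
  case: (boolP (S \in chain T)) => //= Sc.
  have [w -> _] := chain_rep Sc; rewrite !inE !(symT w).
  by have /setP/(_ w) := e; rewrite !inE => ->.
have l_inj : {in chain T &, injective l}.
  move=> S1 S2 S1c S2c; have [x -> _] := chain_rep S1c.
  have [x' -> _] := chain_rep S2c; rewrite !lE => eL.
  by apply/setP => y; rewrite !inE !(symT _ y) !TE eL.
have l_lt : {in chain T, forall S, l S < j}.
  move=> S0 /chain_rep[x -> /set0Pn[y]]; rewrite lE inE => Txy.
  apply: proper_card; apply/properP; split; first by apply/subsetP => S; rewrite inE => /andP[].
  have xNy : T y x by rewrite symT.
  by exists (nbhd T y); [apply: mem_chain xNy | rewrite in_set [x \in _]inE xNy andbF].
(* A member [nbhd T x] contains [y] iff [L x < rank T y], and by bijectivity exactly [rank T y]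
   members satisfy this bound. *)
have Lrank y : L y + rank T y = j.
  have <- : #|[set S in chain T | l S < rank T y]| = rank T y.
    by apply: card_inj_ltn => //; apply/subset_leq_card/subsetP => S; rewrite inE => /andP[].
  rewrite /j -(cardsID [set S : {set 'I_n} | y \notin S] (chain T)).
  congr (_ + _); apply: eq_card => S; rewrite [LHS]in_set.
    by rewrite [RHS]in_setI [X in _ = _ && X]in_set.
  rewrite [RHS]in_setD [X in _ = ~~ X && _]in_set negbK.
  case: (boolP (S \in chain T)) => [Sc|]; last by rewrite andbF.
  by have [x -> _] := chain_rep Sc; rewrite lE inE symT TE andbT.
split=> [x y|k /andP[k0 kj]].
  by rewrite TE -(Lrank y); lia.
have cardk := @card_inj_ltn _ _ l _ l_inj l_lt.
(* Raising the bound [j - k] by one adds a member with [l S = j - k]; an index with that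
   neighbourhood has rank [k]. *)
have : #|[set S in chain T | l S < j - k]| < #|[set S in chain T | l S < (j - k).+1]|.
  by rewrite !cardk -/j; lia.
rewrite ltnNge => /negP h.
have /subsetPn[S] : ~~ ([set S in chain T | l S < (j - k).+1] \subset
                        [set S in chain T | l S < j - k]).
  by apply/negP => /subset_leq_card.
rewrite inE [in X in _ -> X -> _]inE => /andP[Sc lt]; rewrite Sc /= -leqNgt => ge.
have [x e _] := chain_rep Sc; exists x; have := Lrank x; rewrite -lE -e; lia.
Qed.

(** The neighbourhoods are the sets [U (g x)], and [U] grows strictly up to [j] because every class
    from 1 to [j] is inhabited. The chain is therefore [U 1], ..., [U j], of which exactly [g x] lie
    inside [U (g x)]. *)
Lemma rank_unique (n j : nat) (T : rel 'I_n) (g : 'I_n -> nat) :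
  (forall x, g x <= j) -> (forall k, 0 < k <= j -> exists x, g x = k) ->
  (forall x y, T x y = (j < g x + g y)) -> #|chain T| = j /\ rank T =1 g.
Proof.
move=> gj gonto TE.
pose U k := [set y | j < g y + k].
have nbE x : nbhd T x = U (g x) by apply/setP => y; rewrite !inE TE addnC.
have Usub k k' : k <= j -> k' <= j -> (U k \subset U k') = (k <= k').
  move=> kj k'j; apply/idP/idP => [/subsetP sub|le].
    (* An element of class [j.+1 - k] lies in [U k] but not in [U k'] once [k' < k]. *)
    rewrite leqNgt; apply/negP => lt; have [|y gy] := gonto (j.+1 - k); first lia.
    by have := sub y; rewrite !inE gy; lia.
  by apply/subsetP => y; rewrite !inE; lia.
have Uinj : {in [pred k | k <= j] &, injective U}.
  move=> k k'; rewrite !inE => kj k'j e; apply/eqP.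
  by rewrite eqn_leq -Usub // -(Usub k' k) // e subxx.
have cardU k : k <= j -> #|[set U i.+1 | i : 'I_k]| = k.
  move=> kj; rewrite card_in_imset ?card_ord // => a b _ _ e.
  have lek (c : 'I_k) : c.+1 \in [pred i | i <= j] by rewrite inE (leq_trans _ kj).
  exact/val_inj/succn_inj/(Uinj _ _ (lek a) (lek b) e).
have chainE : chain T = [set U i.+1 | i : 'I_j].
  apply/setP => S; rewrite !inE; apply/andP/imsetP.
    case=> S0 /imsetP[x _ e]; move: S0; rewrite e nbE => /set0Pn[y].
    rewrite inE => lt; have gy := gj y; have lx : (g x).-1 < j by have := gj x; lia.
    by exists (Ordinal lx) => //=; rewrite prednK //; lia.
  case=> i _ ->; have [|x gx] := gonto i.+1; first by rewrite /= ltn_ord.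
  split; last by apply/imsetP; exists x => //; rewrite nbE gx.
  have [|y gy] := gonto (j - i); first by have := ltn_ord i; lia.
  by apply/set0Pn; exists y; rewrite inE gy; have := ltn_ord i; lia.
split; first by rewrite chainE cardU.
move=> x; rewrite -[RHS](cardU (g x)) //; apply: eq_card => S; rewrite inE chainE nbE.
apply/andP/imsetP => [[/imsetP[i _ ->]]|[i _ ->]].
  rewrite Usub ?gj //.
  by move=> lt; exists (Ordinal lt).
have ij : i < j := leq_trans (ltn_ord i) (gj x).
split; first by apply/imsetP; exists (Ordinal ij).
by rewrite Usub.
Qed.

(** * The staircase normal form *)

(** With the indices ordered by class, the matrix is zero before the antidiagonal of blocks and [p]
    beyond it. The freedom lies in the blocks on the antidiagonal, where any two non-maximal entries
    of a block share a row or a column. *)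
Definition staircase (p n j : nat) (g : 'I_n -> nat) (M : 'M['I_p.+1]_n) : bool :=
  [&& trmx M == M,
      [forall x, forall y, (0 < M x y) == (j < g x + g y)],
      [forall x, forall y, (j.+1 < g x + g y) ==> (M x y == p :> nat)] &
      [forall x, forall x', forall y, forall y',
        [&& x != x', y != y', g x == g x', g y == g y' & g x + g y == j.+1] ==>
        (M x y == p :> nat) || (M x' y' == p :> nat)]].

Lemma staircaseP (p n j : nat) (g : 'I_n -> nat) (M : 'M['I_p.+1]_n) :
  reflect [/\ forall x y, M x y = M y x,
              forall x y, (0 < M x y) = (j < g x + g y),
              forall x y, j.+1 < g x + g y -> M x y = p :> nat &
              forall x x' y y', x != x' -> y != y' -> g x = g x' -> g y = g y' ->
                g x + g y = j.+1 -> M x y < p -> M x' y' < p -> False]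
          (staircase j g M).
Proof.
apply: (iffP and4P) => [[/eqP sym /'forall_'forall_eqP supp full col]|[sym supp full col]].
  split=> // [x y|x y lt|x x' y y' nx ny gx gy s lt lt'].
  - by rewrite -{1}sym mxE.
  - by apply/eqP; move/forallP: full => /(_ x)/forallP/(_ y)/implyP; apply.
  move: col => /'forall_'forall_'forall_forallP/(_ x x' y y').
  by rewrite nx ny gx gy -s -gx -gy !eqxx /= !ltn_eqF.
split.
- by apply/eqP/matrixP => x y; rewrite mxE sym.
- by apply/'forall_'forall_eqP.
- by apply/'forall_forallP => x y; apply/implyP => /full ->.
apply/'forall_'forall_'forall_forallP => x x' y y'; apply/implyP.
case/and5P=> nx ny /eqP gx /eqP gy /eqP s.
apply/negP => /negP; rewrite negb_or => /andP[ne ne'].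
have lt u v : M u v != p :> nat -> M u v < p by have := ltn_ord (M u v); lia.
by apply: (col x x' y y') => //; apply: lt.
Qed.

Lemma staircase_of_lonesum (p n j : nat) (g : 'I_n -> nat) (M : 'M['I_p.+1]_n) :
  0 < p -> symmetric_strong_lonesum M -> (forall x, g x <= j) ->
  (forall k, 0 < k <= j -> exists x, g x = k) ->
  (forall x y, (0 < M x y) = (j < g x + g y)) -> staircase j g M.
Proof.
move=> p0 /andP[/eqP symM sl] gj gonto supp; apply/staircaseP; split=> //.
- by move=> x y; rewrite -{1}symM mxE.
- move=> x y lt; have gx := gj x; have gy := gj y.
  (* These indices put [(x, y')] and [(x', y)] on the antidiagonal, hence positive, and [(x', y')]
     before it, hence zero; the exchange condition leaves only [M x y = p]. *)
  have [|x' gx'] := gonto (j.+1 - g y); first lia.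
  have [|y' gy'] := gonto (j.+1 - g x); first lia.
  have nx : x != x' by apply/eqP => e; subst x'; lia.
  have ny : y' != y by apply/eqP => e; subst y'; lia.
  have := @strong_lonesum_no_swap _ _ _ M x x' y' y sl nx ny.
  rewrite !supp; have := supp x' y'; have := ltn_ord (M x y); lia.
move=> x x' y y' nx ny gx gy s lt lt'.
have ny' : y' != y by rewrite eq_sym.
have := @strong_lonesum_no_swap _ _ _ M x x' y' y sl nx ny'.
rewrite !supp; lia.
Qed.

(* The weight [g x + g y - j.+1] of an entry splits over rows and columns, so
   its total against a matrix depends only on the row and column sums; a
   staircase matrix maximises it entrywise. *)
Lemma lonesum_of_staircase (p n j : nat) (g : 'I_n -> nat) (M : 'M['I_p.+1]_n) :
  staircase j g M -> symmetric_strong_lonesum M.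
Proof.
case/staircaseP => symM supp full col; apply/andP; split.
  by apply/eqP/matrixP => x y; rewrite mxE symM.
apply/forallP => N; apply/implyP => /andP[/forallP row_eq /forallP col_eq].
pose w x y : int := ((g x)%:Z + (g y)%:Z - (j.+1)%:Z)%R.
have total (A : 'M['I_p.+1]_n) : (\sum_x \sum_y w x y * (A x y)%:Z =
    \sum_x ((g x)%:Z - (j.+1)%:Z) * (row_sum A x)%:Z + \sum_y (g y)%:Z * (col_sum A y)%:Z)%R.
  have rowZ x : ((row_sum A x)%:Z = \sum_y (A x y)%:Z)%R.
    by rewrite -[LHS]natz natr_sum; apply: eq_bigr => y _; rewrite natz.
  have colZ y : ((col_sum A y)%:Z = \sum_x (A x y)%:Z)%R.
    by rewrite -[LHS]natz natr_sum; apply: eq_bigr => x _; rewrite natz.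
  under [X in (_ = _ + X)%R]eq_bigr do rewrite colZ mulr_sumr.
  rewrite [X in (_ = _ + X)%R]exchange_big -big_split; apply: eq_bigr => x _ /=.
  rewrite rowZ mulr_sumr -big_split; apply: eq_bigr => y _ /=.
  by rewrite /w; ring.
(* Before the antidiagonal the weight is negative and [M] vanishes; beyond it the weight is positive
   and [M] is maximal. *)
have ge0 x y : (0 <= w x y * ((M x y)%:Z - (N x y)%:Z))%R.
  have ltM := ltn_ord (M x y); have ltN := ltn_ord (N x y).
  have [lt|gt|eq] := ltngtP (g x + g y) j.+1.
  - have M0 : M x y = 0 :> nat by have := supp x y; lia.
    by rewrite mulr_le0 // /w; lia.
  - by rewrite mulr_ge0 // ?(full x y gt) /w; lia.
  - by have -> : (w x y = 0)%R; [rewrite /w; lia | rewrite mul0r].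
have sum0 : (\sum_x \sum_y w x y * ((M x y)%:Z - (N x y)%:Z) = 0)%R.
  have -> : (\sum_x \sum_y w x y * ((M x y)%:Z - (N x y)%:Z) =
      \sum_x \sum_y w x y * (M x y)%:Z - \sum_x \sum_y w x y * (N x y)%:Z)%R.
    rewrite -sumrB; apply: eq_bigr => x _; rewrite -sumrB.
    by apply: eq_bigr => y _; rewrite mulrBr.
  rewrite !total; apply/eqP; rewrite subr_eq0; apply/eqP.
  congr (_ + _)%R; apply: eq_bigr => x _.
    by rewrite (eqP (row_eq x)).
  by rewrite (eqP (col_eq x)).
(* A zero sum of nonnegative terms vanishes termwise, and the weight is zero only on the
   antidiagonal. *)
have off x y : g x + g y != j.+1 -> N x y = M x y :> nat.
  move=> ne.
  have row0 := psumr_eq0P (fun x _ => sumr_ge0 _ (fun y _ => ge0 x y)) sum0 (i := x) isT.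
  have /eqP := psumr_eq0P (fun y _ => ge0 x y) row0 (i := y) isT.
  by rewrite mulf_eq0 /w; lia.
have exchange (m : nat) (F G : 'I_m -> nat) i : \sum_k F k = \sum_k G k -> F i < G i ->
    exists2 k, k != i & G k < F k.
  move=> eqFG ltFG; case: (boolP [exists k, G k < F k]) => [/existsP[k lt]|].
    by exists k => //; apply/eqP => e; subst k; lia.
  rewrite negb_exists => /forallP le; suff : \sum_k F k < \sum_k G k by rewrite eqFG ltnn.
  rewrite (bigD1 i) //= [X in _ < X](bigD1 i) //= -addSn leq_add //.
  by apply: leq_sum => k _; rewrite leqNgt.
(* An excess of [N] at [(x, y)] forces a deficit at some [(x', y)], then an excess at some
   [(x', y')]. All three lie in one block, where [M] is then non-maximal at [(x, y)] and [(x', y')],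
   in distinct rows and columns. *)
have leNM x y : N x y <= M x y.
  rewrite leqNgt; apply/negP => lt.
  have corner u v : M u v != N u v :> nat -> g u + g v = j.+1.
    by move=> ne; apply/eqP; apply: contraNT ne => /off ->.
  have [x' nx lt'] := exchange _ (M^~ y) (N^~ y) x (esym (eqP (col_eq y))) lt.
  have [y' ny lt''] := exchange _ (N x') (M x') y (eqP (row_eq x')) lt'.
  have c1 := corner x y; have c2 := corner x' y; have c3 := corner x' y'.
  apply: (col x x' y y'); rewrite 1?eq_sym //; try lia.
  - by have := ltn_ord (N x y); lia.
  - by have := ltn_ord (N x' y'); lia.
apply/eqP/matrixP => x y; apply/val_inj/eqP; rewrite /= eqn_leq leNM leqNgt /=.
apply/negP => lt; have [y' _] := exchange _ (N x) (M x) y (eqP (row_eq x)) lt.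
by rewrite ltnNge leNM.
Qed.

(** * Counting fillings of a block by their support *)

(** The value [t] will be the maximal entry, so that the support collects the non-maximal ones. *)
Definition supp (K T : finType) (t : T) (f : {ffun K -> T}) : {set K} :=
  [set u | f u != t].

Definition fills (K T : finType) (t : T) (V : {set T}) (X : {set K}) :
    {set {ffun K -> T}} :=
  [set f : {ffun K -> T} | [forall u, f u \in V] && (supp t f \subset X)].

Lemma fillsP (K T : finType) (t : T) (V : {set T}) (X : {set K}) (f : {ffun K -> T}) :
  reflect ((forall u, f u \in V) /\ supp t f \subset X) (f \in fills t V X).
Proof. by rewrite inE; apply: (iffP andP) => -[/forallP]. Qed.

Lemma card_fills (K T : finType) (t : T) (V : {set T}) (X : {set K}) :
  t \in V -> #|fills t V X| = #|V| ^ #|X|.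
Proof.
move=> tV; rewrite -(card_pffun_on t); apply: eq_card => f.
apply/fillsP/pffun_onP => -[sub fV]; split.
- by apply: subset_trans _ fV; apply/subsetP => u; rewrite !inE.
- by move=> _ /imageP[u _ ->].
- move=> u; case: (boolP (u \in X)) => uX; first by apply: fV; apply: image_f.
  by have /eqP -> : f u == t by apply: contraNT uX => ne; apply: (subsetP sub).
- by apply/subsetP => u; rewrite inE => ne; apply: (subsetP sub).
Qed.

(** Such a filling is constant, or given by one position of [X] and one value of [V] other than
    [t]. *)
Lemma card_fills_le1 (K T : finType) (t : T) (V : {set T}) (X : {set K}) :
  t \in V ->
  #|[set f in fills t V X | #|supp t f| <= 1]| = 1 + #|X| * #|V|.-1.
Proof.
move=> tV; pose single (p : K * T) : {ffun K -> T} :=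
  [ffun u => if u == p.1 then p.2 else t].
have supp_single p : p.2 != t -> supp t (single p) = [set p.1].
  move=> ne; apply/setP => u; rewrite !inE ffunE.
  by case: (eqVneq u p.1) => _; rewrite ?ne ?eqxx.
have cV : #|V :\ t| = #|V|.-1 by rewrite (cardsD1 t V) tV.
pose S := setX X (V :\ t).
have SP p : p \in S -> [/\ p.1 \in X, p.2 \in V & p.2 != t].
  by case: p => a b; rewrite !inE /= => /and3P[].
have supp_const : supp t [ffun=> t] = set0 :> {set K}.
  by apply/setP => u; rewrite !inE ffunE eqxx.
have -> : [set f in fills t V X | #|supp t f| <= 1] = [ffun=> t] |: single @: S.
  apply/setP => f; rewrite !inE; apply/andP/orP.
    case=> /andP[/forallP fV sub]; rewrite leq_eqVlt ltnS leqn0.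
    case/orP => [/cards1P[u su]|]; last first.
      rewrite cards_eq0 => /eqP/setP s0; left; apply/eqP/ffunP => u.
      by have := s0 u; rewrite !inE ffunE => /negbFE/eqP.
    right; apply/imsetP; have : u \in supp t f by rewrite su set11.
    rewrite inE => ne; exists (u, f u).
      by rewrite !inE /= ne fV !andbT (subsetP sub) // su set11.
    apply/ffunP => w; rewrite ffunE /=; case: eqP => [->//|wu].
    have /setP/(_ w) := su; rewrite !inE; move/eqP/negbTE: wu => ->.
    by move/negbFE/eqP.
  case=> [/eqP ->|/imsetP[p /SP[pX pV pt] ->]].
    rewrite supp_const cards0 sub0set; split=> //; rewrite andbT.
    by apply/forallP => u; rewrite ffunE.
  rewrite supp_single // cards1 sub1set pX; split=> //; rewrite andbT.
  by apply/forallP => u; rewrite ffunE; case: ifP.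
rewrite cardsU1; have -> : [ffun=> t] \notin single @: S.
  apply/negP => /imsetP[p /SP[_ _ pt]] /ffunP/(_ p.1); rewrite !ffunE eqxx => e.
  by rewrite -e eqxx in pt.
rewrite card_in_imset ?cardsX ?cV // => p p' /SP[_ _ pt] /SP[_ _ p't] e.
have := supp_single _ pt; rewrite e supp_single // => /setP/(_ p.1).
rewrite !inE eqxx => /eqP e1; have /ffunP/(_ p.1) := e; rewrite !ffunE e1 eqxx.
by case: p p' e1 {pt p't e} => a b [a' b'] /= -> ->.
Qed.

(** With at least two points, a collinear support determines its line, so counting line by line
    counts nothing twice. *)
Definition fills_gt1 (K T : finType) (t : T) (V : {set T}) (X : {set K}) :=
  [set f in fills t V X | 1 < #|supp t f|].

Lemma card_fills_gt1 (K T : finType) (t : T) (V : {set T}) (X : {set K}) :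
  t \in V ->
  ((#|fills_gt1 t V X|)%:Z = #|V|%:Z ^+ #|X| - (#|V|%:Z - 1) * #|X|%:Z - 1)%R.
Proof.
move=> tV; have := cardsID [set f | #|supp t f| <= 1] (fills t V X).
rewrite card_fills //.
have -> : fills t V X :&: [set f | #|supp t f| <= 1] =
    [set f in fills t V X | #|supp t f| <= 1].
  by apply/setP => f; rewrite !inE.
have -> : fills t V X :\: [set f | #|supp t f| <= 1] = fills_gt1 t V X.
  by apply/setP => f; rewrite !inE -ltnNge andbC.
rewrite card_fills_le1 //.
have v0 : 0 < #|V| by apply/card_gt0P; exists t.
have [v ->] : exists v, #|V| = v.+1 by exists #|V|.-1; rewrite prednK.
move=> /= eq; rewrite -[(Posz v.+1)]natz -natrX natz -eq natz.
rewrite !PoszD PoszM -addn1 PoszD; ring.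
Qed.

(** A nonempty support on which [pi] is constant lies in exactly one fibre of [pi]. *)
Lemma card_fills_fiber (K J T : finType) (t : T) (V : {set T}) (X : {set K}) (pi : K -> J) :
  #|[set f in fills_gt1 t V X |
      [forall u in supp t f, forall w in supp t f, pi u == pi w]]|
  = \sum_x #|fills_gt1 t V (X :&: pi @^-1: [set x])|.
Proof.
under eq_bigr do rewrite -sum1_card.
rewrite -sum1_card -partition_disjoint_bigcup /=; last first.
  move=> x x' ne; rewrite -setI_eq0; apply/eqP/setP => f; rewrite in_setI in_set0.
  apply/negP => /andP[/setIdP[/fillsP[_ sub]]] lt /setIdP[/fillsP[_ sub'] _].
  have /card_gt0P[u us] : 0 < #|supp t f| by lia.
  have := subsetP sub u us; have := subsetP sub' u us.
  rewrite !inE => /andP[_ /eqP e'] /andP[_ /eqP e].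
  by rewrite -e -e' eqxx in ne.
apply: eq_bigl => f; apply/setIdP/bigcupP => [[/setIdP[/fillsP[fV sub] lt]]|].
  move=> /'forall_in_'forall_in_eqP eqpi.
  have /card_gt0P[u us] : 0 < #|supp t f| by lia.
  exists (pi u) => //; apply/setIdP; split=> //; apply/fillsP; split=> //.
  by apply/subsetP => w ws; rewrite !inE (subsetP sub) //= (eqpi w ws u us).
case=> x _ /setIdP[/fillsP[fV sub] lt]; split.
  apply/setIdP; split=> //; apply/fillsP; split=> //.
  by apply: subset_trans sub _; apply: subsetIl.
apply/'forall_in_'forall_in_eqP => u us w ws.
have := subsetP sub u us; have := subsetP sub w ws.
by rewrite !inE => /andP[_ /eqP ->] /andP[_ /eqP ->].
Qed.

Definition collinear (I J : finType) (u w : I * J) := (u.1 == w.1) || (u.2 == w.2).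

Definition line_fills (I J T : finType) (t : T) (V : {set T}) (X : {set I * J}) :=
  [set f in fills t V X | [forall u in supp t f, forall w in supp t f, collinear u w]].

(** A pairwise collinear support has at most one point or lies, with at least two, in one row or in
    one column; these cases are disjoint. For [#|V| = q - 1] the total is [fq q #|A| #|C|]. *)
Lemma card_line_fills (I J T : finType) (t : T) (V : {set T}) (A : {set I}) (C : {set J}) :
  t \in V ->
  ((#|line_fills t V (setX A C)|)%:Z = 1 + #|A|%:Z * #|C|%:Z * (#|V|%:Z - 1)
     + #|A|%:Z * (#|V|%:Z ^+ #|C| - (#|V|%:Z - 1) * #|C|%:Z - 1)
     + #|C|%:Z * (#|V|%:Z ^+ #|A| - (#|V|%:Z - 1) * #|A|%:Z - 1))%R.
Proof.
move=> tV; set X := setX A C.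
pose L (L' : finType) (pi : I * J -> L') := [set f in fills_gt1 t V X |
   [forall u in supp t f, forall w in supp t f, pi u == pi w]].
have LP L' pi f : reflect [/\ f \in fills t V X, 1 < #|supp t f| &
    {in supp t f &, forall u w, pi u = pi w}] (f \in L L' pi).
  apply: (iffP setIdP) => [[/setIdP[fX lt] /'forall_in_'forall_in_eqP eqpi]|[fX lt eqpi]].
    by split=> // u w us; apply: eqpi.
  split; first exact/setIdP.
  by apply/'forall_in_'forall_in_eqP => u us w; apply: eqpi.
have gt1P (f : {ffun I * J -> T}) : 1 < #|supp t f| ->
    exists2 u, u \in supp t f & exists2 w, w \in supp t f & u != w.
  by move=> /card_gt1P[u [w [us ws ne]]]; exists u => //; exists w.
have -> : line_fills t V X =
    [set f in fills t V X | #|supp t f| <= 1] :|: (L _ fst :|: L _ snd).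
  apply/setP => f; apply/setIdP/setUP => [[fX /'forall_in_forall_inP col]|].
    have [le|gt] := leqP #|supp t f| 1; first by left; apply/setIdP.
    have {}col u w : u \in supp t f -> w \in supp t f -> collinear u w.
      by move=> us ws; apply: col.
    right; have [u us [w ws ne]] := gt1P f gt; apply/setUP.
    have [e1|ne1] := eqVneq u.1 w.1.
      have ne2 : u.2 != w.2.
        by apply: contraNneq ne => e2; case: u w e1 e2 {us ws} => a b [a' b'] /= -> ->.
      (* A point off the common row of [u] and [w] would share its column with both, although their
         columns differ. *)
      have z1 z : z \in supp t f -> z.1 = u.1.
        move=> zs; apply/eqP; have := col z u zs us; have := col z w zs ws.
        rewrite /collinear -e1; case: (z.1 == u.1) => //= /eqP -> /eqP e.
        by rewrite e eqxx in ne2.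
      by left; apply/LP; split=> // z z' /z1 -> /z1 ->.
    have e2 : u.2 = w.2 by have := col u w us ws; rewrite /collinear (negbTE ne1) => /eqP.
    have z2 z : z \in supp t f -> z.2 = u.2.
      move=> zs; apply/eqP; have := col z u zs us; have := col z w zs ws.
      rewrite /collinear -e2; case: (z.2 == u.2); rewrite // !orbF => /eqP -> /eqP e.
      by rewrite e eqxx in ne1.
    by right; apply/LP; split=> // z z' /z2 -> /z2 ->.
  case=> [/setIdP[fX le]|/setUP[/LP[fX _ e]|/LP[fX _ e]]]; split=> //;
    apply/'forall_in_forall_inP => u us w ws.
  - by rewrite /collinear (card_le1_eqP le u w us ws) eqxx.
  - by rewrite /collinear (e u w us ws) eqxx.
  - by rewrite /collinear (e u w us ws) eqxx orbT.
(* Fibres outside [E] miss [X] and contribute [1 - 0 - 1 = 0]. *)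
have cardL (L' : finType) (pi : I * J -> L') (E : {set L'}) k :
    (forall x, #|X :&: pi @^-1: [set x]| = if x \in E then k else 0) ->
    ((#|L _ pi|)%:Z = #|E|%:Z * (#|V|%:Z ^+ k - (#|V|%:Z - 1) * k%:Z - 1))%R.
  move=> cardX; rewrite card_fills_fiber -[LHS]natz natr_sum.
  under eq_bigr do rewrite natz card_fills_gt1 // cardX.
  rewrite (bigID (mem E)) /= [X in (_ + X)%R]big1 => [|x /negbTE ->]; last by rewrite expr0; ring.
  rewrite addr0; under eq_bigr => x -> do []; rewrite sumr_const -mulr_natl natz //.
rewrite cardsU cardsU.
have -> : L _ fst :&: L _ snd = set0.
  apply/setP => f; rewrite in_set0; apply/negbTE/negP => /setIP[/LP[_ gt e1] /LP[_ _ e2]].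
  have [u us [w ws]] := gt1P f gt; rewrite [u]surjective_pairing [w]surjective_pairing.
  by rewrite (e1 u w) // (e2 u w) // eqxx.
have -> : [set f in fills t V X | #|supp t f| <= 1] :&: (L _ fst :|: L _ snd) = set0.
  apply/setP => f; rewrite in_set0; apply/negbTE/negP => /setIP[/setIdP[_]].
  by rewrite leqNgt => /negP le /setUP[] /LP[_ gt _].
rewrite cards0 !subn0 card_fills_le1 // cardsX !PoszD (cardL _ fst A #|C|) ?(cardL _ snd C #|A|).
- have v0 : 0 < #|V| by apply/card_gt0P; exists t.
  have eV : (Posz #|V|.-1 = #|V|%:Z - 1)%R by lia.
  by rewrite !PoszM eV; ring.
- move=> x; case: ifPn => xC.
    rewrite -[RHS]muln1 -(cards1 x) -cardsX; apply: eq_card => -[a b]; rewrite !inE /=.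
    by case: eqP => [->|]; rewrite ?xC ?andbT ?andbF.
  apply/eqP; rewrite cards_eq0; apply/eqP/setP => -[a b]; rewrite !inE /=.
  by case: eqP => [->|]; rewrite ?(negbTE xC) ?andbF.
move=> x; case: ifPn => xA.
  rewrite -[RHS]mul1n -(cards1 x) -cardsX; apply: eq_card => -[a b]; rewrite !inE /=.
  by case: eqP => [->|]; rewrite ?xA ?andbT ?andbF.
apply/eqP; rewrite cards_eq0; apply/eqP/setP => -[a b]; rewrite !inE /=.
by case: eqP => [->|]; rewrite ?(negbTE xA) ?andbF.
Qed.

(** * Fillings of the corner blocks *)

Definition fiber (n : nat) (g : 'I_n -> nat) (m : nat) : {set 'I_n} := [set x | g x == m].

Definition positive (p : nat) : {set 'I_p.+1} := [set v : 'I_p.+1 | 0 < v].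

Lemma card_positive (p : nat) : #|positive p| = p.
Proof.
rewrite -[RHS](card_ord p) -(card_imset _ (@lift_inj p.+1 ord0)); apply: eq_card => v.
rewrite inE; apply/idP/imsetP => [v0|[w _ ->] //].
case: (unliftP ord0 v) => [w ->|e]; first by exists w.
by rewrite e in v0.
Qed.

(* The non-maximal entries of a symmetric staircase matrix whose row class is
   [m] and whose column class is [j.+1 - m]; the transposed block is then
   determined, which is why only [m <= j.+1 - m] carries any choice. *)
Definition corner_fills (p n j : nat) (g : 'I_n -> nat) (m : nat) :
    {set {ffun 'I_n * 'I_n -> 'I_p.+1}} :=
  if m.*2 < j.+1 then
    line_fills ord_max (positive p) (setX (fiber g m) (fiber g (j.+1 - m)))
  else if m.*2 == j.+1 then
    [set f in fills ord_max (positive p) [set (x, x) | x in fiber g m] |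
      #|supp ord_max f| <= 1]
  else [set [ffun=> ord_max]].

(** One set of conditions for all three ranges of [m], as needed for gluing. In the middle block
    symmetry couples [(x, y)] with [(y, x)], collinear only for [x = y]; hence the diagonal clause,
    which leaves at most one non-maximal entry. *)
Lemma corner_fillsP (p n j : nat) (g : 'I_n -> nat) (m : nat)
    (f : {ffun 'I_n * 'I_n -> 'I_p.+1}) : 0 < p ->
  reflect [/\ forall x y, 0 < f (x, y),
              forall x y, f (x, y) != ord_max ->
                [/\ g x = m, m.*2 <= j.+1 & g x + g y = j.+1],
              forall x y x' y', f (x, y) != ord_max -> f (x', y') != ord_max ->
                x = x' \/ y = y' &
              m.*2 = j.+1 -> forall x y, f (x, y) != ord_max -> x = y]
          (f \in corner_fills p j g m).
Proof.
move=> p0; rewrite /corner_fills; case: (ltngtP m.*2 j.+1) => [lt|gt|eq].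
- apply: (iffP setIdP) => [[/fillsP[fV /subsetP sub] /'forall_in_forall_inP col]|[pos cor col _]].
    split.
    + by move=> x y; have := fV (x, y); rewrite inE.
    + move=> x y ne; have := sub (x, y); rewrite !inE ne => /(_ isT) /andP[/eqP gx /eqP gy].
      by split=> //=; rewrite ?gx ?gy; move: gx gy => /=; lia.
    + move=> x y x' y' ne ne'; have := col (x, y) _ (x', y').
      by rewrite !inE => /(_ ne ne') /orP[/eqP|/eqP]; [left|right].
    + by move=> e; move: lt; rewrite e ltnn.
  split.
    apply/fillsP; split; first by case=> x y; rewrite inE.
    apply/subsetP => -[x y]; rewrite !inE /= => /cor[-> _ e]; rewrite eqxx /=.
    by apply/eqP; lia.
  apply/'forall_in_forall_inP => -[x y] us [x' y'] ws; rewrite !inE in us ws.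
  by have [->|->] := col _ _ _ _ us ws; rewrite /collinear eqxx ?orbT.
- apply: (iffP set1P) => [->|[_ cor _ _]].
    split=> [x y|x y|x y x' y'|_ x y]; first by rewrite ffunE.
    - by rewrite ffunE eqxx.
    - by rewrite ffunE eqxx.
    - by rewrite ffunE eqxx.
  apply/ffunP => -[x y]; rewrite ffunE; by apply/eqP/negPn/negP => /cor[].
apply: (iffP setIdP) => [[/fillsP[fV /subsetP sub] /card_le1_eqP le1]|[pos cor col diag]].
  have xx x y : f (x, y) != ord_max -> x = y /\ g x = m.
    move=> ne; have := sub (x, y); rewrite !inE ne => /(_ isT) /imsetP[z].
    by rewrite inE => /eqP gz [-> ->].
  split.
  - by move=> x y; have := fV (x, y); rewrite inE.
  - by move=> x y /xx[<- ->]; split=> //; lia.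
  - by move=> x y x' y' ne ne'; left; have := le1 (x, y) (x', y'); rewrite !inE => /(_ ne ne') [].
  - by move=> _ x y /xx[].
split.
  apply/fillsP; split; first by case=> x y; rewrite inE.
  apply/subsetP => -[x y]; rewrite inE => ne; apply/imsetP; exists x.
    by rewrite inE; have [-> _ _] := cor _ _ ne.
  by rewrite (diag eq _ _ ne).
apply/card_le1_eqP => -[x y] [x' y']; rewrite !inE => ne ne'.
have e := diag eq _ _ ne; have e' := diag eq _ _ ne'; subst y y'.
by case: (col _ _ _ _ ne ne') => ->.
Qed.

Lemma card_corner_fills (p n j : nat) (g : 'I_n -> nat) (m : nat) : 0 < p ->
  ((#|corner_fills p j g m|)%:Z =
     if (m.*2 < j.+1)%N then fq p.+1 #|fiber g m| #|fiber g (j.+1 - m)%N|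
     else if (m.*2 == j.+1)%N then 1 + (p.+1%:Z - 2) * #|fiber g m|%:Z else 1)%R.
Proof.
move=> p0; have tV : ord_max \in positive p by rewrite inE.
have pE : (p.+1%:Z - 1 = p%:Z)%R by lia.
rewrite /corner_fills; case: ifP => _; last case: ifP => _.
- rewrite card_line_fills // card_positive /fq pE.
  have -> : (p.+1%:Z - 2 = p%:Z - 1)%R by lia.
  by ring.
- rewrite card_fills_le1 // card_positive card_imset => [|x y [] //].
  have -> : (p.+1%:Z - 2 = p.-1%:Z)%R by lia.
  by rewrite PoszD PoszM mulrC.
- by rewrite cards1.
Qed.

Lemma prod_card_corner_fills (p n j : nat) (g : 'I_n -> nat) :
  0 < p -> (forall x, g x <= j) ->
  ((\prod_(m < j.+1) #|corner_fills p j g m|)%N%:Z =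
   (\prod_(1 <= i < (j./2).+1) fq p.+1 #|fiber g i| #|fiber g (j.+1 - i)%N|) *
   (if odd j then 1 + (p.+1%:Z - 2) * #|fiber g (j./2).+1|%:Z else 1))%R.
Proof.
move=> p0 gj; rewrite -[LHS]natz natr_prod.
under eq_bigr do rewrite natz card_corner_fills //.
set G := (F in (\prod_(i < j.+1) F i)%R).
rewrite -(big_mkord xpredT (fun m =>
     if (m.*2 < j.+1)%N then fq p.+1 #|fiber g m| #|fiber g (j.+1 - m)%N|
     else if (m.*2 == j.+1)%N then 1 + (p.+1%:Z - 2) * #|fiber g m|%:Z else 1)%R) {G}.
have jE := odd_double_half j.
rewrite big_ltn // {1}/fq subn0.
(* Class 0 is paired with the empty class [j.+1], and [fq q r 0 = 1], so its factor disappears. *)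
have -> : fiber g j.+1 = set0 by apply/setP => x; rewrite !inE; have := gj x; lia.
rewrite cards0 /= expr0 (big_cat_nat (n := (j./2).+1)) //=; last lia.
rewrite mulrA; congr (_ * _)%R.
  rewrite [X in (X * _)%R](_ : _ = 1)%R ?mul1r; last by ring.
  by apply: eq_big_nat => i /andP[_ lt]; rewrite ifT //; lia.
case: ifP => oj.
  rewrite oj in jE; have mid : (j./2).+1.*2 = j.+1 by lia.
  rewrite big_ltn; last lia.
  rewrite mid ltnn eqxx big_nat_cond big1 ?mulr1 // => i; rewrite andbT => /andP[lt _].
  by rewrite !ifF //; lia.
rewrite oj in jE; rewrite big_nat_cond big1 // => i; rewrite andbT => /andP[lt _].
by rewrite !ifF //; lia.
Qed.

(** * Assembling a matrix from its corner fillings *)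

(** Reading each entry from the filling of its smaller class builds in symmetry, except where the
    row and column classes coincide. *)
Definition glue (p n j : nat) (g : 'I_n -> nat)
    (L : {ffun 'I_j.+1 -> {ffun 'I_n * 'I_n -> 'I_p.+1}}) : 'M['I_p.+1]_n :=
  (\matrix_(x, y) if (g x + g y <= j)%N then ord0
    else if (g x <= g y)%N then L (inord (g x)) (x, y) else L (inord (g y)) (y, x))%R.

(** [glue] is a bijection from families of corner fillings onto staircase matrices; its inverse
    reads off the antidiagonal blocks and puts [ord_max] elsewhere. *)
Lemma card_staircase (p n j : nat) (g : 'I_n -> nat) :
  0 < p -> (forall x, g x <= j) ->
  #|[set M : 'M['I_p.+1]_n | staircase j g M]| = \prod_(m < j.+1) #|corner_fills p j g m|.
Proof.
move=> p0 gj.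
pose F (m : 'I_j.+1) := corner_fills p j g m.
pose Fs := [set L : {ffun 'I_j.+1 -> {ffun 'I_n * 'I_n -> 'I_p.+1}} | L \in family F].
have <- : #|Fs| = \prod_(m < j.+1) #|corner_fills p j g m|.
  by rewrite cardsE card_family foldrE big_image.
have FP (L : {ffun 'I_j.+1 -> {ffun 'I_n * 'I_n -> 'I_p.+1}}) :
    reflect (forall m, L m \in F m) (L \in Fs).
  by rewrite inE; apply: familyP.
have maxE (v : 'I_p.+1) : (v == ord_max) = (p <= v).
  by rewrite -val_eqE /= eqn_leq -ltnS ltn_ord.
have off (L : {ffun 'I_j.+1 -> {ffun 'I_n * 'I_n -> 'I_p.+1}}) (m : 'I_j.+1) x y :
    L \in Fs ->
    ~~ [&& g x == m, g x <= g y & g x + g y == j.+1] -> L m (x, y) = ord_max.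
  move=> /FP/(_ m)/corner_fillsP-/(_ p0)[_ cor _ _]; apply: contraNeq => /cor[gx le e].
  by rewrite e gx !eqxx /= andbT; lia.
rewrite -(card_in_imset (f := @glue p n j g)) => [|L L' LF L'F eqL]; last first.
  apply/ffunP => m; apply/ffunP => -[x y].
  case: (boolP [&& g x == m, g x <= g y & g x + g y == j.+1]) => [|ne]; last by rewrite !off.
  case/and3P=> /eqP gx le /eqP e; have /matrixP/(_ x y) := eqL.
  by rewrite !mxE e ltnn le gx inord_val.
apply: eq_card => M; rewrite inE; apply/idP/imsetP => [/staircaseP[symM posM full col]|[L LF ->]].
  pose L := [ffun m : 'I_j.+1 => [ffun u : 'I_n * 'I_n =>
    if [&& g u.1 == m, g u.1 <= g u.2 & g u.1 + g u.2 == j.+1] then M u.1 u.2 else ord_max]].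
  have LE m x y : L m (x, y) != ord_max ->
    [/\ g x = m, g x <= g y, g x + g y = j.+1 & M x y < p].
    rewrite !ffunE /=; case: ifP => [/and3P[/eqP ? ? /eqP ?]|]; last by rewrite eqxx.
    by rewrite maxE -ltnNge => lt; split.
  exists L.
    apply/FP => m; apply/corner_fillsP => //; split.
    - move=> x y; rewrite !ffunE /=; case: ifP => // /and3P[_ _ /eqP e].
      by rewrite posM e.
    - by move=> x y /LE[gx le e _]; split=> //; lia.
    - move=> x y x' y' /LE[gx le e lt] /LE[gx' le' e' lt'].
      have [->|nx] := eqVneq x x'; first by left.
      have [->|ny] := eqVneq y y'; first by right.
      by case: (col x x' y y' nx ny) => //; lia.
    (* By symmetry [(y, x)] would be a second non-maximal entry, sharing neither row nor column with
       [(x, y)]. *)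
    - move=> mid x y /LE[gx le e lt]; apply/eqP/negPn/negP => ne.
      case: (col x y y x) => //; rewrite 1?eq_sym //; try lia.
      by rewrite symM.
  apply/matrixP => x y; rewrite mxE !ffunE /= !inordK ?ltnS ?gj // !eqxx /=.
  case: leqP => [le|gt]; first by apply/val_inj => /=; have := posM x y; lia.
  have top u v : j < g u + g v -> g u + g v != j.+1 -> M u v = ord_max.
    by move=> l ne; apply/val_inj; rewrite /= full //; lia.
  case: leqP => le /=.
    by case: eqP => // /eqP ne; apply: top.
  rewrite (ltnW le) /= symM; case: eqP => // /eqP ne; apply: top => //; lia.
have LP (m : 'I_j.+1) := elimT (corner_fillsP j g m (L m) p0) (elimT (FP L) LF m).
have ofull x y (m : 'I_j.+1) : g x + g y != j.+1 -> L m (x, y) = ord_max.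
  move=> ne; apply: off => //; by rewrite (negbTE ne) !andbF.
apply/staircaseP; split.
- move=> x y; rewrite !mxE [g y + g x]addnC; case: leqP => // lt; case: ltngtP => // e.
  have [->//|nxy] := eqVneq x y.
  (* For equal classes both readings come from one filling at transposed positions; off the diagonal
     both are maximal. *)
  have diag u v : u != v -> g u = g x -> g v = g x -> L (inord (g x)) (u, v) = ord_max.
    move=> ne gu gv; have [_ c _ d] := LP (inord (g x)).
    apply/eqP/negPn/negP => nm; have [_ _ s] := c _ _ nm.
    by move: ne; rewrite (d _ _ _ nm) ?eqxx // inordK ?ltnS ?gj //; lia.
  by rewrite -e (diag x y) // (diag y x) // eq_sym.
- move=> x y; rewrite mxE; case: (leqP (g x + g y) j) => // lt.
  have [posx _ _ _] := LP (inord (g x)); have [posy _ _ _] := LP (inord (g y)).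
  by case: (g x <= g y); rewrite ?posx ?posy.
- move=> x y lt; rewrite mxE leqNgt (ltnW lt) /=; have ne : g x + g y != j.+1 by lia.
  by case: (g x <= g y); rewrite ofull // addnC.
move=> x x' y y' nx ny gx gy s; rewrite !mxE -gx -gy s ltnn.
case: (g x <= g y) => lt lt'.
  have [_ _ c _] := LP (inord (g x)); have [||e|e] := c x y x' y'.
  - by rewrite maxE -ltnNge.
  - by rewrite maxE -ltnNge.
  - by rewrite e eqxx in nx.
  - by rewrite e eqxx in ny.
have [_ _ c _] := LP (inord (g y)); have [||e|e] := c y x y' x'.
- by rewrite maxE -ltnNge.
- by rewrite maxE -ltnNge.
- by rewrite e eqxx in ny.
- by rewrite e eqxx in nx.
Qed.

(** * Class functions with given fibre sizes *)

Lemma card_fiber_sum (n k : nat) (g : {ffun 'I_n -> 'I_k}) (i : 'I_k) :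
  #|fiber (fun x => g x) i| = \sum_x (g x == i).
Proof.
rewrite -sum1_card big_mkcond /=; apply: eq_bigr => x _.
by rewrite inE -val_eqE /=; case: (_ == _).
Qed.

Lemma sum_card_fiber (n k : nat) (g : {ffun 'I_n -> 'I_k}) :
  \sum_(i < k) #|fiber (fun x => g x) i| = n.
Proof.
under eq_bigr do rewrite card_fiber_sum.
rewrite exchange_big /= -[RHS]card_ord -sum1_card; apply: eq_bigr => x _.
by rewrite (bigD1 (g x)) //= eqxx big1 // => i; rewrite eq_sym => /negbTE ->.
Qed.

Definition with_fibers (n k : nat) (t : 'I_k -> nat) : {set {ffun 'I_n -> 'I_k}} :=
  [set g : {ffun 'I_n -> 'I_k} | [forall i : 'I_k, #|fiber (fun x => g x) i| == t i]].

Lemma with_fibersP (n k : nat) (t : 'I_k -> nat) (g : {ffun 'I_n -> 'I_k}) :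
  reflect (forall i : 'I_k, \sum_x (g x == i) = t i) (g \in with_fibers n t).
Proof.
rewrite inE; apply: (iffP 'forall_eqP) => h i; have := h i; by rewrite card_fiber_sum.
Qed.

(** Induction on [n] by the class [i] of the first index: the other indices have fibre sizes [t]
    lowered by one at [i], which gives [t i] times the factorial of [n]; the [t i] sum to [n.+1]. *)
Lemma card_with_fibers (n k : nat) (t : 'I_k -> nat) :
  \sum_i t i = n -> #|with_fibers n t| * \prod_i (t i)`! = n`!.
Proof.
elim: n t => [|n IHn] t sum_t.
  have t0 i : t i = 0 by apply/eqP; move/eqP: sum_t; rewrite sum_nat_eq0 => /forallP/(_ i).
  rewrite big1 ?muln1 => [|i _]; last by rewrite t0.
  rewrite (@eq_card1 _ (ffun0 (card_ord 0))) // => g.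
  have -> : g = (ffun0 (card_ord 0)) by apply/ffunP => -[].
  by rewrite [RHS]inE eqxx; apply/with_fibersP => i; rewrite big_ord0 t0.
pose rest (h : {ffun 'I_n -> 'I_k}) i : {ffun 'I_n.+1 -> 'I_k} :=
  [ffun x => if unlift ord0 x is Some y then h y else i].
have sum_rest h i i' : \sum_x (rest h i x == i') = (i == i') + \sum_x (h x == i').
  rewrite big_ord_recl ffunE unlift_none; congr (_ + _).
  by apply: eq_bigr => x _; rewrite ffunE liftK.
have rest_inj i : injective (rest ^~ i).
  by move=> h h' /ffunP e; apply/ffunP => x; have := e (lift ord0 x); rewrite !ffunE liftK.
pose t' i i' := t i' - (i == i').
have step i : #|[set g in with_fibers n.+1 t | g ord0 == i]| * \prod_i (t i)`! = t i * n`!.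
  have sub : [set g in with_fibers n.+1 t | g ord0 == i] \subset
      [set rest h i | h in with_fibers n (t' i)].
    apply/subsetP => g /setIdP[/with_fibersP gt /eqP g0].
    have eg : g = rest [ffun x => g (lift ord0 x)] i.
      by apply/ffunP => x; rewrite !ffunE; case: unliftP => [y ->|->//]; rewrite ffunE.
    rewrite eg; apply/imsetP; eexists; last by []; apply/with_fibersP => i'.
    by rewrite /t' -gt {2}eg sum_rest addKn.
  (* For [t i = 0] the truncated subtraction in [t' i] would be wrong; no function counted here
     takes the value [i]. *)
  case: (posnP (t i)) => [ti0|ti_gt0].
    rewrite ti0 (_ : [set g in _ | _] = set0) ?cards0 //.
    apply/setP => g; rewrite in_set0; apply/negP => /setIdP[/with_fibersP/(_ i)].
    by rewrite ti0 big_ord_recl => + g0; rewrite g0.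
  have -> : [set g in with_fibers n.+1 t | g ord0 == i] =
      [set rest h i | h in with_fibers n (t' i)].
    apply/eqP; rewrite eqEsubset sub; apply/subsetP => _ /imsetP[h /with_fibersP ht ->].
    apply/setIdP; split; last by rewrite ffunE unlift_none.
    apply/with_fibersP => i'; rewrite sum_rest ht /t'.
    by case: eqP => [<-|_] /=; [rewrite subnKC | rewrite subn0].
  rewrite card_imset //.
  have t'i : t' i i = (t i).-1 by rewrite /t' eqxx subn1.
  have t'ne i' : i' != i -> t' i i' = t i' by rewrite /t' eq_sym => /negbTE ->; rewrite subn0.
  rewrite -(IHn (t' i)); last first.
    have := sum_t; rewrite (bigD1 i) //= => e; rewrite (bigD1 i) //= t'i.
    by rewrite (eq_bigr _ t'ne); apply: succn_inj; rewrite -addSn (prednK ti_gt0).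
  rewrite (bigD1 i) //= [X in _ = _ * (_ * X)](bigD1 i) //= t'i.
  rewrite [X in _ = _ * (_ * (_ * X))](eq_bigr (fun i' => (t i')`!)) => [|i' /t'ne -> //].
  by rewrite -{1}(prednK ti_gt0) factS (prednK ti_gt0) -mulnA mulnCA.
rewrite -sum1_card (partition_big (fun g : {ffun 'I_n.+1 -> 'I_k} => g ord0) xpredT) //=.
rewrite big_distrl /= factS -[X in _ = X * _]sum_t big_distrl /=; apply: eq_bigr => i _.
rewrite -step -sum1_card; congr (_ * _); apply: eq_bigl => g.
by rewrite inE.
Qed.

(** * Splitting the count by rank functions *)

(** Class 0, which will hold the indices of zero rows, may be empty. *)
Definition surjects (n j : nat) (g : {ffun 'I_n -> 'I_j.+1}) : bool :=
  [forall k : 'I_j.+1, (0 < k) ==> [exists x, g x == k]].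

Lemma surjectsP (n j : nat) (g : {ffun 'I_n -> 'I_j.+1}) :
  reflect (forall k, 0 < k <= j -> exists x, g x = k :> nat) (surjects g).
Proof.
apply: (iffP forallP) => [h k /andP[k0 kj]|h k]; last first.
  apply/implyP => k0; have [|x gx] := h k; first by rewrite k0 -ltnS ltn_ord.
  by apply/existsP; exists x; rewrite -val_eqE /= gx.
have := h (Ordinal (kj : k < j.+1)); rewrite /= k0 /= => /existsP[x /eqP gx].
by exists x; rewrite gx.
Qed.

(** A symmetric strong lonesum matrix is staircase for [j] the length of its chain of supports and
    [g] its rank function, and by [rank_unique] for no other such pair. *)
Lemma card_lonesum_surjects (p n : nat) : 0 < p ->
  B p.+1 n = \sum_(j < n.+1) \sum_(g : {ffun 'I_n -> 'I_j.+1} | surjects g)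
    #|[set M : 'M['I_p.+1]_n | staircase j (fun x => g x) M]|.
Proof.
move=> p0; pose T (M : 'M['I_p.+1]_n) : rel 'I_n := fun x y => 0 < M x y.
pose h j M : {ffun 'I_n -> 'I_j.+1} := [ffun x => inord (rank (T M) x)].
pose d (M : 'M['I_p.+1]_n) : 'I_n.+1 := Ordinal (chain_le (T M) : _ < n.+1).
rewrite /B -sum1_card (partition_big d xpredT) //=; apply: eq_bigr => j _.
have lonesumE (M : 'M['I_p.+1]_n) : symmetric_strong_lonesum M ->
    (forall x y, (0 < M x y) = (#|chain (T M)| < rank (T M) x + rank (T M) y)) /\
    (forall k, 0 < k <= #|chain (T M)| -> exists x, rank (T M) x = k).
  move=> /andP[/eqP symM sl]; apply: mem_nbhd_rank_add.
    by move=> x y; rewrite /T -{1}symM mxE.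
  move=> x x' y y' Txy Tx'y'; rewrite /T.
  have [<-|nx] := eqVneq x x'; first by apply/orP; right.
  have [<-|ny] := eqVneq y y'; first by apply/orP; left.
  have := strong_lonesum_no_swap sl nx ny Txy Tx'y'.
  by case/orP => /(leq_trans p0) ->; rewrite ?orbT.
have rank_le (M : 'M['I_p.+1]_n) x : rank (T M) x <= #|chain (T M)|.
  by apply/subset_leq_card/subsetP => S /setIdP[].
have toM (g : {ffun 'I_n -> 'I_j.+1}) (M : 'M['I_p.+1]_n) :
    surjects g -> staircase j (fun x => g x) M -> d M = j /\ h j M = g.
  move=> /surjectsP sg /staircaseP[_ supp _ _].
  have gj x : g x <= j by rewrite -ltnS.
  have [dj rg] := rank_unique gj sg (supp : forall x y, T M x y = _).
  by split; [apply: val_inj | apply/ffunP => x; rewrite ffunE rg inord_val].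
have fromM (M : 'M['I_p.+1]_n) : symmetric_strong_lonesum M -> d M = j ->
    surjects (h j M) /\ staircase j (fun x => h j M x) M.
  move=> sM /(congr1 val) /= dj; have [supp onto] := lonesumE M sM; rewrite dj in supp onto.
  have hE x : h j M x = rank (T M) x :> nat by rewrite ffunE inordK // ltnS -dj.
  have sh k : 0 < k <= j -> exists x, h j M x = k :> nat.
    by move=> /onto[x <-]; exists x; rewrite hE.
  split; first exact/surjectsP.
  apply: staircase_of_lonesum => // [x|x y]; first by rewrite -ltnS.
  by rewrite !hE.
rewrite (partition_big (h j) (@surjects n j)) /=; last first.
  by move=> M /andP[]; rewrite inE => sM /eqP dM; have [] := fromM M sM dM.
apply: eq_bigr => g sg; rewrite -sum1_card; apply: eq_bigl => M; rewrite !inE.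
apply/andP/idP => [[/andP[sM /eqP dM] /eqP hM]|st].
  by have [_] := fromM M sM dM; rewrite hM.
have [-> ->] := toM g M sg st; rewrite !eqxx; split=> //; rewrite andbT.
exact: lonesum_of_staircase st.
Qed.

(** * Multinomial coefficients and the order of the classes *)

(** Class functions are grouped by their tuple of fibre sizes: the multinomial coefficient counts
    those with a given tuple, and positivity in [inS] amounts to surjectivity. *)
Lemma sum_multinom (n j : nat) (W : {ffun 'I_j.+1 -> 'I_n.+1} -> int) :
  (\sum_(t : {ffun 'I_j.+1 -> 'I_n.+1} | inS t)
      (multinom n [seq Defs.comp t k | k <- iota 0 j.+1])%:Z * W t =
   \sum_(g : {ffun 'I_n -> 'I_j.+1} | surjects g)
      W [ffun i : 'I_j.+1 => inord #|fiber (fun x => g x) i|])%R.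
Proof.
pose c (g : {ffun 'I_n -> 'I_j.+1}) : {ffun 'I_j.+1 -> 'I_n.+1} :=
  [ffun i : 'I_j.+1 => inord #|fiber (fun x => g x) i|].
have cE g i : c g i = #|fiber (fun x => g x) i| :> nat.
  by rewrite ffunE inordK // ltnS -[X in _ <= X]card_ord max_card.
have sum_c g : \sum_i c g i = n.
  by under eq_bigr do rewrite cE; apply: sum_card_fiber.
have inS_c g : inS (c g) = surjects g.
  rewrite /inS sum_c eqxx /=; apply: eq_forallb => k; rewrite cE; congr (_ ==> _).
  apply/card_gt0P/existsP => -[x]; first by rewrite inE => gx; exists x.
  by move=> /eqP gx; exists x; rewrite inE gx.
rewrite [RHS](partition_big c (@inS n j)) /=; last by move=> g; rewrite inS_c.
apply: eq_bigr => t tS.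
rewrite (eq_bigr (fun=> W t)) => [|g /andP[_ /eqP <-] //].
rewrite sumr_const -[RHS]mulr_natl natz; congr (Posz _ * _)%R.
have /andP[/eqP sum_t _] := tS.
rewrite -[_ :: _]/[seq Defs.comp t k | k <- index_iota 0 j.+1].
have -> : multinom n [seq Defs.comp t k | k <- index_iota 0 j.+1] =
    n`! %/ \prod_i (t i)`!.
  rewrite /multinom big_map big_mkord; congr (_ %/ _); apply: eq_bigr => i _.
  by rewrite /Defs.comp inord_val.
rewrite -(card_with_fibers sum_t) mulnK; last by apply/prodn_gt0 => i; apply: fact_gt0.
apply: eq_card => g; rewrite inE; apply/forallP/andP => [gt|[_ /eqP <- i]]; last by rewrite cE.
have ct : c g = t by apply/ffunP => i; apply/val_inj; rewrite /= cE (eqP (gt i)).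
by rewrite -inS_c ct.
Qed.

(* Classes [i] and [j.+1 - i] meet in a corner block; the formula lists such a
   pair at the consecutive positions [2i - 1] and [2i]. *)
Definition pair_class (j k : nat) : nat :=
  if odd k then k.+1./2 else if k == 0 then 0 else j.+1 - k./2.

Lemma pair_class_le (j k : nat) : k <= j -> pair_class j k <= j.
Proof. by rewrite /pair_class => kj; have := odd_double_half k; do ?case: ifP; lia. Qed.

Lemma pair_class_inj (j k k' : nat) :
  k <= j -> k' <= j -> pair_class j k = pair_class j k' -> k = k'.
Proof.
rewrite /pair_class => kj k'j; have := odd_double_half k; have := odd_double_half k'.
by do ?case: ifP; lia.
Qed.

Definition relabel (j : nat) (k : 'I_j.+1) : 'I_j.+1 := inord (pair_class j k).

Lemma relabelE (j : nat) (k : 'I_j.+1) : relabel k = pair_class j k :> nat.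
Proof. by rewrite inordK // ltnS pair_class_le // -ltnS. Qed.

Lemma relabel_inj (j : nat) : injective (@relabel j).
Proof.
move=> k k' e; have le (i : 'I_j.+1) : i <= j by rewrite -ltnS.
by apply/val_inj/(pair_class_inj (le k) (le k')); rewrite -!relabelE e.
Qed.

(** [relabel] permutes the classes and fixes 0, so composition with it permutes the class functions
    satisfying [surjects]. *)
Lemma sum_relabel (n j : nat) (F : {ffun 'I_n -> 'I_j.+1} -> int) :
  (\sum_(g : {ffun 'I_n -> 'I_j.+1} | surjects g) F g =
   \sum_(g : {ffun 'I_n -> 'I_j.+1} | surjects g) F [ffun x => relabel (g x)])%R.
Proof.
have inj : injective (fun g : {ffun 'I_n -> 'I_j.+1} => [ffun x => relabel (g x)]).
  move=> g g' /ffunP e; apply/ffunP => x; apply: relabel_inj.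
  by have := e x; rewrite !ffunE.
rewrite (reindex _ (onW_bij _ (injF_bij inj))) /=; apply: eq_bigl => g.
have relabel0 (k : 'I_j.+1) : (0 < relabel k) = (0 < k).
  have kj : k <= j by rewrite -ltnS.
  by rewrite relabelE /pair_class; have := odd_double_half k; do ?case: ifP; lia.
apply/forallP/forallP => h k.
  have := h (relabel k); rewrite relabel0; case: (0 < k) => //= /existsP[x].
  by rewrite ffunE => /eqP/relabel_inj <-; apply/existsP; exists x.
have -> : k = relabel (invF (@relabel_inj j) k) by rewrite f_invF.
rewrite relabel0; have := h (invF (@relabel_inj j) k).
case: (0 < _) => //= /existsP[x /eqP gx].
by apply/existsP; exists x; rewrite ffunE gx.
Qed.

Lemma card_fiber_relabel (n j : nat) (g : {ffun 'I_n -> 'I_j.+1}) (k : nat) : k <= j ->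
  #|fiber (fun x => [ffun x => relabel (g x)] x) (pair_class j k)| =
  #|fiber (fun x => g x) k|.
Proof.
move=> kj; apply: eq_card => x; rewrite !inE ffunE relabelE.
by apply/eqP/eqP => [/pair_class_inj|->] //; apply; rewrite // -ltnS.
Qed.

(** For a tuple of sum [n], the last difference is the component at [j] if [j] is odd and 0
    otherwise: the size of the unpaired middle class. *)
Definition weight (q n j : nat) (t : {ffun 'I_j.+1 -> 'I_n.+1}) : int :=
  ((\prod_(1 <= i < (j./2).+1) fq q (Defs.comp t (2 * i - 1)) (Defs.comp t (2 * i)))
   * (1 + (q%:Z - 2) * (n%:Z - (\sum_(0 <= i < (j./2).*2.+1) Defs.comp t i)%N%:Z)))%R.

Lemma card_relabel_staircase (p n j : nat) (g : {ffun 'I_n -> 'I_j.+1}) : 0 < p ->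
  ((#|[set M : 'M['I_p.+1]_n | staircase j (fun x => [ffun x => relabel (g x)] x) M]|)%:Z =
   weight p.+1 [ffun i : 'I_j.+1 => inord #|fiber (fun x => g x) i| : 'I_n.+1])%R.
Proof.
move=> p0; have gj x : [ffun x => relabel (g x)] x <= j by rewrite -ltnS.
pose t : {ffun 'I_j.+1 -> 'I_n.+1} :=
  [ffun i : 'I_j.+1 => inord #|fiber (fun x => g x) i|].
rewrite card_staircase // prod_card_corner_fills // /weight -/t.
have tE k : k <= j -> Defs.comp t k = #|fiber (fun x => g x) k|.
  move=> kj; rewrite /Defs.comp ffunE inordK inordK //.
  by rewrite ltnS -[X in _ <= X]card_ord max_card.
have jE := odd_double_half j.
congr (_ * _)%R.
  apply: eq_big_nat => i /andP[i1 ij].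
  (* Positions [2 * i - 1] and [2 * i] carry the sizes of the matching classes [i] and
     [j.+1 - i]. *)
  have e1 : pair_class j (2 * i - 1) = i.
    by rewrite /pair_class ifT; lia.
  have e2 : pair_class j (2 * i) = j.+1 - i.
    by rewrite /pair_class !ifF; lia.
  by rewrite -e2 -{1}e1 !card_fiber_relabel ?tE //; lia.
have sum_t : \sum_(0 <= i < j.+1) Defs.comp t i = n.
  rewrite big_mkord -[RHS](sum_card_fiber g).
  by apply: eq_bigr => i _; rewrite tE -1?ltnS.
case: ifP => oj; rewrite oj in jE.
  have ej : pair_class j j = (j./2).+1 by rewrite /pair_class oj; lia.
  rewrite -ej card_fiber_relabel // -tE //.
  rewrite (_ : (j./2).*2.+1 = j); last lia.
  rewrite -{2}sum_t big_nat_recr //= PoszD.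
  by ring.
rewrite (_ : (j./2).*2.+1 = j.+1) ?sum_t; last lia.
by ring.
Qed.

Theorem theorem3p7 (q n : nat) (hq : (2 <= q)%N) (hn : (1 <= n)%N) :
  ((B q n)%:Z = formula q n)%R.
Proof.
case: q hq => // p p0; rewrite card_lonesum_surjects // -[LHS]natz natr_sum.
under eq_bigr => j _.
  rewrite natr_sum; under eq_bigr do rewrite natz.
  (* The classes are reordered first, so that the fibre sizes appear in the order of the formula
     when grouped into tuples. *)
  rewrite sum_relabel; under eq_bigr do rewrite card_relabel_staircase //.
  rewrite -sum_multinom; over.
rewrite big_ord_recl /formula; congr (_ + _)%R.
  (* For [j = 0] the only tuple is [(n)], with coefficient and weight 1: the zero matrix, giving the
     leading 1. *)
  have inS0 (t : {ffun 'I_1 -> 'I_n.+1}) : inS t = (t == [ffun=> ord_max]).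
    rewrite /inS big_ord1; apply/andP/eqP => [[/eqP tn _]|->].
      by apply/ffunP => i; rewrite ffunE (ord1 i); apply/val_inj.
    split; first by rewrite ffunE.
    by apply/forallP => i; rewrite (ord1 i).
  rewrite (big_pred1 _ inS0) /weight /multinom /= big_seq1 big_geq // big_nat1.
  by rewrite /Defs.comp ffunE /= divnn fact_gt0 subrr mulr0 addr0 !mulr1.
rewrite big_add1 big_mkord; apply: eq_bigr => j _; apply: eq_bigr => t _.
by rewrite /weight mulrA.
Qed.
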